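(* Let $(M,g)$ be a 2-dimensional Riemannian manifold, let $p\in M$, and let $K$ be the Gaussian curvature at $p$. Then the nonzero M-eigenvalue of the Riemann curvature tensor at $p$ is $K$; that is, a nonzero real number $\zeta$ is an M-eigenvalue of the Riemann curvature tensor at $p$ if and only if $\zeta=K$.
   Context: Let $\nabla$ be the Levi-Civita connection of $g$ and $\langle\cdot,\cdot\rangle=g$. Convention: $R(X,Y)=[\nabla_X,\nabla_Y]-\nabla_{[X,Y]}$, $R(W,Z,X,Y)=\langle W,R(X,Y)Z\rangle$, and in local coordinates $R_{ijkl}=R(\partial_i,\partial_j,\partial_k,\partial_l)$. In dimension 2 the Gaussian curvature is $K=R_{1212}/\det(g_{ij})$, and $R_{abcd}=K(g_{ac}g_{bd}-g_{ad}g_{bc})$. M-eigenvalue: a real number $\zeta$ is an M-eigenvalue of the Riemann curvature tensor at $p$ if there are vectors $x,y\in T_pM$ with $$R(y,x)x=\zeta y,\qquad R(x,y)y=\zeta x,\qquad \langle x,x\rangle=\langle y,y\rangle=1.$$ *)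

(* Defs.v *)
From HB Require Import structures.
From mathcomp Require Import all_boot all_order all_algebra.
From mathcomp Require Import all_classical all_reals all_analysis.
Import Order.TTheory GRing.Theory Num.Theory.
Import numFieldNormedType.Exports.

Set Implicit Arguments.
Unset Strict Implicit.
Unset Printing Implicit Defensive.

Local Open Scope classical_set_scope.
Local Open Scope ring_scope.

Section Smooth.
Context {R : realType} {n : nat}.
Implicit Types (U : set 'rV[R]_n) (f : 'rV[R]_n -> R).

Definition partial (i : 'I_n) f (u : 'rV[R]_n) : R := 'D_(delta_mx 0 i) f u.

Fixpoint Ck (k : nat) U f : Prop :=
  if k is k'.+1 then
    (forall u, U u -> differentiable f u) /\
    (forall i : 'I_n, Ck k' U (partial i f))
  else forall u, U u -> {for u, continuous f}.

Definition smooth U f : Prop := forall k : nat, Ck k U f.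

End Smooth.

(* [param] is the inverse of [coord] on the open set [coord @` dom]; the values
   of [coord] off [dom] and of [param] off [coord @` dom] are irrelevant. *)
Record chart (R : realType) (n : nat) (T : topologicalType) := Chart {
  dom : set T;
  coord : T -> 'rV[R]_n;
  param : 'rV[R]_n -> T;
  dom_open : open dom;
  image_open : open (coord @` dom);
  coordK : forall q, dom q -> param (coord q) = q;
  coord_continuous : forall q, dom q -> {for q, continuous coord};
  param_continuous :
    forall u, (coord @` dom) u -> {for u, continuous param} }.

Record manifold (R : realType) (n : nat) := Manifold {
  space :> topologicalType;
  space_hausdorff : hausdorff_space space;
  space_second_countable : @second_countable space;
  chart_index : Type;
  atlas : chart_index -> chart R n space;
  atlas_cover : forall q : space, exists c, dom (atlas c) q;
  atlas_smooth : forall (c c' : chart_index) (j : 'I_n),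
    smooth (coord (atlas c) @` (dom (atlas c) `&` dom (atlas c')))
      (fun u => coord (atlas c') (param (atlas c) u) 0 j) }.

Section Manifold.
Context {R : realType} {n : nat} {M : manifold R n}.
Implicit Types (c : chart_index M) (p q : M) (W : set M) (f : M -> R).

Definition Dom c : set M := dom (atlas c).
Definition Coord c : M -> 'rV[R]_n := coord (atlas c).
Definition Param c : 'rV[R]_n -> M := param (atlas c).

(* Row i holds the i-th partial derivatives of the transition map from c to
   c', so that it acts on row vectors of components from the right. *)
Definition jac c c' q : 'M[R]_n :=
  \matrix_(i < n, j < n)
    partial i (fun u => Coord c' (Param c u) 0 j) (Coord c q).

Definition chart_at q : chart_index M := projT1 (cid (atlas_cover q)).

Definition smooth_on W f : Prop :=
  forall c, smooth (Coord c @` (W `&` Dom c)) (f \o Param c).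

(* A tangent vector at p is the family of its components in all the charts
   around p, related by the Jacobians of the transition maps.  Components in
   the other charts are set to 0, so that equality of tangent vectors is
   equality of families, and the pointwise operations of
   [chart_index M -> 'rV[R]_n] are the operations of the tangent space. *)
Definition tangent p (x : chart_index M -> 'rV[R]_n) : Prop :=
  (forall c c', Dom c p -> Dom c' p -> x c' = x c *m jac c c' p) /\
  (forall c, ~ Dom c p -> x c = 0).

Definition tfield : Type := M -> chart_index M -> 'rV[R]_n.
Implicit Types (X Y Z : tfield).

(* [tfield] contains arbitrary families; [vfield W X] says that X restricts to
   a smooth vector field on W (the values off W are irrelevant). *)
Definition vfield W X : Prop :=
  (forall q, W q -> tangent q (X q)) /\
  (forall c (i : 'I_n),
     smooth (Coord c @` (W `&` Dom c)) (fun u => X (Param c u) c 0 i)).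

Definition fscale f X : tfield := fun q => f q *: X q.

Definition dir c X f q : R :=
  \sum_(i < n) X q c 0 i * partial i (f \o Param c) (Coord c q).

(* The function X f; the chart used at q is immaterial. *)
Definition deriv_along X f q : R := dir (chart_at q) X f q.

Definition lie X Y : tfield := fun q c =>
  if `[< Dom c q >] then
    \row_(i < n) (dir c X (fun r => Y r c 0 i) q
                  - dir c Y (fun r => X r c 0 i) q)
  else 0.

(* The coordinate field d/du_i of the chart c, on [Dom c]. *)
Definition dd c (i : 'I_n) : tfield := fun q c' =>
  if `[< Dom c q /\ Dom c' q >] then row i (jac c c' q) else 0.

End Manifold.
Arguments tfield {R n} M.

Record riemannian (R : realType) (n : nat) := Riemannian {
  base :> manifold R n;
  metric : base -> (chart_index base -> 'rV[R]_n) -> (chart_index base -> 'rV[R]_n) -> R;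
  metric_sym : forall p x y, tangent p x -> tangent p y ->
    metric p x y = metric p y x;
  metric_linear : forall p (a : R) x y z,
    tangent p x -> tangent p y -> tangent p z ->
    metric p (a *: x + y) z = a * metric p x z + metric p y z;
  metric_pos : forall p x, tangent p x -> x != 0 -> 0 < metric p x x;
  metric_smooth : forall (W : set base) (X Y : tfield base),
    open W -> vfield W X -> vfield W Y ->
    smooth_on W (fun q => metric q (X q) (Y q)) }.

Section Riemannian.
Context {R : realType} {n : nat} {M : riemannian R n}.
Implicit Types (W : set M) (X Y Z : tfield M) (D : tfield M -> tfield M -> tfield M).

(* D X Y is the covariant derivative of Y along X.  A connection acts on the
   vector fields over every open W, compatibly with restriction; by locality a
   single operator on families represents all of these actions. *)
Record connection D : Prop := Connection {
  conn_vfield : forall W X Y, open W -> vfield W X -> vfield W Y ->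
    vfield W (D X Y);
  conn_local : forall W X X' Y Y', open W ->
    vfield W X -> vfield W X' -> vfield W Y -> vfield W Y' ->
    {in W, X =1 X'} -> {in W, Y =1 Y'} -> {in W, D X Y =1 D X' Y'};
  conn_addl : forall W X X' Y, open W ->
    vfield W X -> vfield W X' -> vfield W Y ->
    {in W, D (X + X') Y =1 D X Y + D X' Y};
  conn_scalel : forall W f X Y, open W ->
    smooth_on W f -> vfield W X -> vfield W Y ->
    {in W, D (fscale f X) Y =1 fscale f (D X Y)};
  conn_addr : forall W X Y Y', open W ->
    vfield W X -> vfield W Y -> vfield W Y' ->
    {in W, D X (Y + Y') =1 D X Y + D X Y'};
  conn_leibniz : forall W f X Y, open W ->
    smooth_on W f -> vfield W X -> vfield W Y ->
    {in W, D X (fscale f Y) =1 fscale (deriv_along X f) Y + fscale f (D X Y)} }.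

Record levi_civita D : Prop := LeviCivita {
  lc_connection : connection D;
  lc_torsion_free : forall W X Y, open W -> vfield W X -> vfield W Y ->
    {in W, D X Y - D Y X =1 lie X Y};
  lc_metric : forall W X Y Z, open W ->
    vfield W X -> vfield W Y -> vfield W Z ->
    {in W, deriv_along X (fun q => metric q (Y q) (Z q)) =1
      fun q => metric q (D X Y q) (Z q) + metric q (Y q) (D X Z q)} }.

Definition curv D X Y Z : tfield M :=
  D X (D Y Z) - D Y (D X Z) - D (lie X Y) Z.

(* R(x, y) z = w for tangent vectors at p, through arbitrary local extensions
   of x, y, z to vector fields. *)
Definition riemann_at D (p : M) (x y z w : chart_index M -> 'rV[R]_n) : Prop :=
  forall W X Y Z, open W -> W p -> vfield W X -> vfield W Y -> vfield W Z ->
    X p = x -> Y p = y -> Z p = z -> curv D X Y Z p = w.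

Definition M_eigenvalue D (p : M) (zeta : R) : Prop :=
  exists x y, [/\ tangent p x, tangent p y,
    riemann_at D p y x x (zeta *: y), riemann_at D p x y y (zeta *: x)
    & metric p x x = 1 /\ metric p y y = 1].

(* Components in the local coordinates of the chart c. *)
Definition gij (c : chart_index M) (p : M) : 'M[R]_n :=
  \matrix_(i < n, j < n) metric p (dd c i p) (dd c j p).

Definition Rijkl D (c : chart_index M) (p : M) (i j k l : 'I_n) : R :=
  metric p (dd c i p) (curv D (dd c k) (dd c l) (dd c j) p).

End Riemannian.

(* The indices 1 and 2 are [ord0] and [ord_max]. *)
Definition gaussian_curvature (R : realType) (M : riemannian R 2)
    (D : tfield M -> tfield M -> tfield M) (c : chart_index M) (p : M) : R :=
  Rijkl D c p ord0 ord_max ord0 ord_max / \det (gij c p).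

(* Main.v *)
Require Import Defs.
From mathcomp Require Import all_boot all_order all_algebra.
From mathcomp Require Import all_classical all_reals all_analysis.
From mathcomp Require Import ring lra.
Import Order.TTheory GRing.Theory Num.Theory.
Import numFieldNormedType.Exports.
Set Implicit Arguments.
Unset Strict Implicit.
Unset Printing Implicit Defensive.
Local Open Scope classical_set_scope.
Local Open Scope ring_scope.

(** The curvature is tensorial, so at p it is given by its components
    R_ijkl in a coordinate frame; these are skew in (i, j) because the
    connection is metric, and skew in (k, l) by definition.  In dimension 2
    this leaves R_1212 alone, and Gram's identity for the determinant of the
    metric turns that into
      <R(y,x)x, w> = K (<x,x> <y,w> - <x,y> <x,w>).
    If R(y,x)x = zeta y with x, y unit and zeta nonzero, taking w = x gives
    <x,y> = 0, and then w = y gives zeta = K.  Conversely any orthonormal pair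
    has eigenvalue K. *)

(** * Calculus of C^k functions *)

(** [riemann_at] quantifies over every local extension of three tangent vectors, so nothing can be
    computed from an eigenvalue equation until the curvature is known to depend only on values at
    the point. That is the bulk of the work. Two steps are not formal consequences of the connection
    axioms: linearity over functions in the third slot, and skewness with respect to the metric.
    Both rest on one analytic fact, that the bracket acts on functions as the commutator of
    derivations, which in coordinates is the symmetry of second partial derivatives. This is why a
    calculus of C^k functions up to that symmetry comes first. Charts add a further layer: the
    derivative of a function along a field is taken in a chosen chart, and the chain rule shows that
    the choice is immaterial. The value 0 is always an M-eigenvalue in dimension 2, since [x = y]
    gives R(x,x)x = 0; the restriction to nonzero values is what forces the eigenvectors to be
    orthogonal. *)

Lemma near_eq_differentiable (R : numFieldType) (V W : normedModType R)
    (f g : V -> W) (a : V) :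
  (\near a, f a = g a) -> differentiable f a -> differentiable g a.
Proof.
move=> fg df; have [cdf fE] := (diff_locallyP _ _).1 df.
have gE : g \o shift a = cst (g a) + 'd f a +o_ 0 id.
  apply/eqaddoP => e e0; move/eqaddoP : fE => /(_ e e0) fe.
  have fg0 : \forall h \near (0 : V), f (h + a) = g (h + a).
    by move: fg; rewrite (near_shift 0 a) /= subr0; apply: filterS => h.
  near=> h.
  have : `|(f \o shift a - (cst (f a) + 'd f a)) h| <= e * `|id h|.
    by near: h; exact: fe.
  rewrite /= !fctE /= (nbhs_singleton fg).
  by have -> // : f (h + a) = g (h + a) by near: h.
(* The differential of [g] is a chosen value until an expansion is known; uniqueness of the linear
   part identifies it with that of [f]. *)
have /= dE := diff_unique cdf gE.
by apply/diff_locallyP; rewrite dE; split.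
Unshelve. all: by end_near. Qed.

Section Ck_theory.
Context {R : realType}.

Lemma partial_ext n (i : 'I_n) (U : set 'rV[R]_n) (f g : 'rV[R]_n -> R) u :
  open U -> {in U, f =1 g} -> U u -> partial i f u = partial i g u.
Proof.
move=> oU fg Uu; apply: near_eq_derive; near=> v.
by apply: fg; rewrite inE; near: v; exact: open_nbhs_nbhs.
Unshelve. all: by end_near. Qed.

(** A function read in a chart is meaningful only on the image of the chart, so identities are
    available on [U] alone; openness lets partial derivatives inherit them. *)
Lemma Ck_ext n k (U : set 'rV[R]_n) (f g : 'rV[R]_n -> R) :
  open U -> {in U, f =1 g} -> Ck k U f -> Ck k U g.
Proof.
move=> oU; elim: k f g => [|k IH] f g fg /=.
  move=> fc u Uu; have Uu' : u \in U by rewrite inE.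
  rewrite /prop_for /continuous_at /= -(fg u Uu'); apply: cvg_trans (fc u Uu).
  apply: (near_eq_cvg (F := nbhs u)); near=> v; apply: fg; rewrite inE; near: v.
  exact: open_nbhs_nbhs.
move=> [df pf]; split.
  move=> u Uu; apply: near_eq_differentiable (df u Uu); near=> v.
  by apply: fg; rewrite inE; near: v; exact: open_nbhs_nbhs.
move=> i; apply: IH (pf i) => u; rewrite inE; exact: partial_ext.
Unshelve. all: by end_near. Qed.

Lemma CkW n k (U : set 'rV[R]_n) (f : 'rV[R]_n -> R) :
  Ck k.+1 U f -> Ck k U f.
Proof.
elim: k f => [|k IH] f [df pf].
  by move=> u /df /differentiable_continuous.
by split=> // i; apply: IH (pf i).
Qed.

Lemma Ck_sub n k (U V : set 'rV[R]_n) (f : 'rV[R]_n -> R) :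
  U `<=` V -> Ck k V f -> Ck k U f.
Proof.
move=> UV; elim: k f => [|k IH] f; first by move=> fc u /UV; exact: fc.
by move=> [df pf]; split=> [u /UV/df//|i]; apply: IH (pf i).
Qed.

Lemma partial_cst n (i : 'I_n) (a : R) : partial i (cst a) = cst 0.
Proof. by apply/funext => u; exact: derive_cst. Qed.

Lemma Ck_cst n k (U : set 'rV[R]_n) (a : R) : Ck k U (cst a).
Proof.
elim: k a => [|k IH] a; first by move=> u _; exact: cst_continuous.
by split=> [u _|i]; [exact: differentiable_cst|rewrite partial_cst].
Qed.

Lemma partialD n (i : 'I_n) (f g : 'rV[R]_n -> R) u :
  differentiable f u -> differentiable g u ->
  partial i (fun v => f v + g v) u = partial i f u + partial i g u.
Proof.
move=> df dg; rewrite /partial -[X in derive X _ _]/(f + g).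
by rewrite deriveD//; exact: diff_derivable.
Qed.

Lemma partialM n (i : 'I_n) (f g : 'rV[R]_n -> R) u :
  differentiable f u -> differentiable g u ->
  partial i (fun v => f v * g v) u = f u * partial i g u + g u * partial i f u.
Proof.
move=> df dg; rewrite /partial -[X in derive X _ _]/(f * g).
by rewrite deriveM//; exact: diff_derivable.
Qed.

Lemma CkD n k (U : set 'rV[R]_n) (f g : 'rV[R]_n -> R) : open U ->
  Ck k U f -> Ck k U g -> Ck k U (fun u => f u + g u).
Proof.
move=> oU; elim: k f g => [|k IH] f g.
  by move=> fc gc u Uu; exact: (continuousD (fc u Uu) (gc u Uu)).
move=> [df pf] [dg pg]; split=> [u Uu|i].
  by apply: differentiableD; [exact: df|exact: dg].
apply: Ck_ext oU _ (IH _ _ (pf i) (pg i)) => u.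
by rewrite inE => Uu; rewrite partialD//; [exact: df|exact: dg].
Qed.

Lemma CkM n k (U : set 'rV[R]_n) (f g : 'rV[R]_n -> R) : open U ->
  Ck k U f -> Ck k U g -> Ck k U (fun u => f u * g u).
Proof.
move=> oU; elim: k f g => [|k IH] f g.
  by move=> fc gc u Uu; exact: (continuousM (fc u Uu) (gc u Uu)).
move=> Cf Cg; have [[df pf] [dg pg]] := (Cf, Cg); split=> [u Uu|i].
  by apply: differentiableM; [exact: df|exact: dg].
(* The product rule keeps one factor undifferentiated, and [CkW] lowers that factor to the class of
   the induction hypothesis. *)
have Cfg := CkD oU (IH _ _ (CkW Cf) (pg i)) (IH _ _ (CkW Cg) (pf i)).
apply: Ck_ext oU _ Cfg => u.
by rewrite inE => Uu; rewrite partialM//; [exact: df|exact: dg].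
Qed.

Lemma Ck_sum n k (U : set 'rV[R]_n) (I : Type) (r : seq I)
    (f : I -> 'rV[R]_n -> R) : open U ->
  (forall i, Ck k U (f i)) -> Ck k U (fun u => \sum_(i <- r) f i u).
Proof.
move=> oU Cf; elim: r => [|i r IH].
  by apply: Ck_ext oU _ (Ck_cst k U 0) => u _; rewrite big_nil.
apply: Ck_ext oU _ (CkD oU (Cf i) IH) => u _; by rewrite big_cons.
Qed.

Section Composition.
Context {m n : nat} (phi : 'rV[R]_m -> 'rV[R]_n).
Let phi_sum : phi = fun u => \sum_(j < n) phi u 0 j *: delta_mx 0 j.
Proof. by apply/funext => u; exact: row_sum_delta. Qed.

Lemma continuous_row u :
  (forall j, {for u, continuous (fun v => phi v 0 j)}) ->
  {for u, continuous phi}.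
Proof.
move=> pc; rewrite {}phi_sum /continuous_at.
apply: (@cvg_big _ _ _ _ _ _ _ (nbhs u) _ _ _ _) => [|j _].
  exact: add_continuous.
by apply: cvgZ; [exact: pc|exact: cvg_cst].
Qed.

Lemma differentiable_row u :
  (forall j, differentiable (fun v => phi v 0 j) u) -> differentiable phi u.
Proof.
move=> pd; rewrite phi_sum.
rewrite [X in differentiable X _](_ : _ =
  \sum_(j < n) fun u => phi u 0 j *: (delta_mx 0 j : 'rV[R]_n)).
  by apply: differentiable_sum => j; apply: differentiableZl.
by apply/funext => v; rewrite fct_sumE.
Qed.

Lemma partial_comp (f : 'rV[R]_n -> R) i u :
  (forall j, differentiable (fun v => phi v 0 j) u) ->
  differentiable f (phi u) ->
  partial i (f \o phi) u =
    \sum_(j < n) partial j f (phi u) * partial i (fun v => phi v 0 j) u.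
Proof.
move=> pd fd; have pdu := differentiable_row pd.
rewrite /partial deriveE; last exact: differentiable_comp.
(* Expanding the image vector under the differential of [phi] in the standard basis turns linearity
   of the differential of [f] into the sum over [j]. *)
rewrite diff_comp//= [X in 'd f _ X]row_sum_delta linear_sum /=.
apply: eq_bigr => j _; rewrite linearZ /= -[LHS]/(_ * _) mulrC; congr (_ * _).
  by rewrite -deriveE.
by rewrite -deriveE// derive_mx ?mxE//; exact: diff_derivable.
Qed.

(* Induction on k: by the chain rule the partial derivatives of the composite
   are again sums of products of composites. *)
Lemma Ck_comp k (U : set 'rV[R]_m) (V : set 'rV[R]_n) (f : 'rV[R]_n -> R) :
  open U -> (forall u, U u -> V (phi u)) ->
  (forall j, Ck k U (fun u => phi u 0 j)) -> Ck k V f -> Ck k U (f \o phi).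
Proof.
move=> oU UV; elim: k f => [|k IH] f pc fc.
  move=> u Uu; apply: continuous_comp; last exact/fc/UV.
  by apply: continuous_row => j; exact: pc.
have [df pf] := fc; split=> [u Uu|i].
  apply: differentiable_comp; last exact/df/UV.
  by apply: differentiable_row => j; have [+ _] := pc j; exact.
have : Ck k U (fun u => \sum_(j < n)
    partial j f (phi u) * partial i (fun v => phi v 0 j) u).
  apply: Ck_sum => // j; apply: CkM => //.
    by apply: IH (pf j) => // l; exact/CkW.
  by have [_] := pc j; exact.
apply: Ck_ext => // u; rewrite inE => Uu; rewrite partial_comp//.
  by move=> j; have [+ _] := pc j; exact.
exact/df/UV.
Qed.

End Composition.

End Ck_theory.

(** * Symmetry of second partial derivatives *)

Section Schwarz.
Context {R : realType}.

Let translate_quotient (V W : normedModType R) (f : V -> W) (a x v : V) :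
  (fun h : R => h^-1 *: (f (h *: v + x + a) - f (x + a))) =
  (fun h : R => h^-1 *: (f (h *: v + (x + a)) - f (x + a))).
Proof. by apply/funext => h; rewrite addrA. Qed.

Lemma derive_translate (V W : normedModType R) (f : V -> W) (a x v : V) :
  'D_v (fun w => f (w + a)) x = 'D_v f (x + a).
Proof. by rewrite /derive translate_quotient. Qed.

Lemma derivable_translate (V W : normedModType R) (f : V -> W) (a x v : V) :
  derivable f (x + a) v -> derivable (fun w => f (w + a)) x v.
Proof. by rewrite /derivable translate_quotient. Qed.

(** The one-variable mean value theorem applies to [G s = g (u + s *: v)], because the difference
    quotients of [G] are those of [g] in direction [v]. *)
Lemma MVT_line (V : normedModType R) (g : V -> R) (u v : V) (h : R) : 0 <= h ->
  (forall s, s \in `[0, h] -> derivable g (u + s *: v) v) ->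
  exists2 s, s \in `[0, h] & g (u + h *: v) - g u = h * 'D_v g (u + s *: v).
Proof.
move=> h0 dg; pose G s := g (u + s *: v).
have GE s : (fun k : R => k^-1 *: (G (k *: 1 + s) - G s)) =
    (fun k : R => k^-1 *: (g (k *: v + (u + s *: v)) - g (u + s *: v))).
  apply/funext => k; rewrite /G; congr (_ *: (g _ - _)).
  by rewrite [k *: 1]mulr1 scalerDl addrCA.
have dG s : s \in `[0, h] -> is_derive s 1 G ('D_v g (u + s *: v)).
  move=> sh; have := dg s sh; rewrite /derivable -GE => dGs.
  by apply: DeriveDef => //; rewrite /derive -GE.
have cG : {within `[0, h], continuous G}.
  apply: derivable_within_continuous => s sh.
  exact: (@ex_derive _ _ _ _ _ _ _ (dG s sh)).
have dG' s : s \in `]0, h[ -> is_derive s 1 G ('D_v g (u + s *: v)).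
  by move=> sh; apply: dG; apply: subset_itv_oo_cc sh.
have [s sh GhE] := MVT_segment h0 dG' cG.
by exists s => //; rewrite mulrC -[h in _ * h]subr0 -GhE /G scale0r addr0.
Qed.

(** The mean value theorem is used twice: in direction [v] on the increment of [f] by [h *: w], then
    in direction [w] on ['D_v f]. The left side is symmetric in [v] and [w] while the mixed
    derivative on the right is taken in a definite order, which is what a comparison of the two
    orders needs. *)
Lemma second_difference (V : normedModType R) (f : V -> R) (u v w : V) (h : R) :
  0 <= h ->
  (forall s t, s \in `[0, h] -> t \in `[0, h] ->
     derivable f (u + s *: v + t *: w) v /\
     derivable ('D_v f) (u + s *: v + t *: w) w) ->
  exists s t, [/\ s \in `[0, h], t \in `[0, h] &
    f (u + h *: v + h *: w) - f (u + h *: v) - f (u + h *: w) + f u =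
    h ^+ 2 * 'D_w ('D_v f) (u + s *: v + t *: w)].
Proof.
move=> h0 df.
have h0h : h \in `[0, h] by rewrite in_itv /= h0 lexx.
have h00 : 0 \in `[0, h] by rewrite in_itv /= h0 lexx.
have d0 s : s \in `[0, h] -> derivable f (u + s *: v) v.
  by move=> sh; have [+ _] := df s 0 sh h00; rewrite scale0r addr0.
have dh s : s \in `[0, h] -> derivable (fun x => f (x + h *: w)) (u + s *: v) v.
  by move=> sh; have [+ _] := df s h sh h0h; exact: derivable_translate.
have [s sh E1] := @MVT_line V ((fun x => f (x + h *: w)) - f) u v h h0
  (fun s sh => derivableB (dh s sh) (d0 s sh)).
have [t th E2] := @MVT_line V ('D_v f) (u + s *: v) w h h0
  (fun t th => (df s t sh th).2).
exists s, t; split => //.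
rewrite expr2 -mulrA -E2 -derive_translate -deriveB; [|exact: dh|exact: d0].
rewrite -E1 !fctE; ring.
Qed.

(* By the mean value theorem, the second difference of f over a small square is
   h^2 times either mixed derivative at some point of the square. *)
Lemma partialC n (U : set 'rV[R]_n) (f : 'rV[R]_n -> R) i j u :
  open U -> Ck 2 U f -> U u ->
  partial i (partial j f) u = partial j (partial i f) u.
Proof.
move=> oU [df pf] Uu.
(* A and B are kept opaque: comparing the two mixed derivatives by conversion
   does not terminate in practice. *)
have [A AE] : exists A, A = partial i (partial j f) := ex_intro _ _ erefl.
have [B BE] : exists B, B = partial j (partial i f) := ex_intro _ _ erefl.
rewrite -AE -BE; apply/eqP; rewrite -subr_eq0 -normr_eq0.
apply/negPn/negP => neq0.
pose e := `|A u - B u| / 2.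
have e0 : 0 < e by rewrite divr_gt0// lt_neqAle eq_sym neq0 normr_ge0.
have cA : {for u, continuous A} by rewrite AE; exact: ((pf j).2 i u Uu).
have cB : {for u, continuous B} by rewrite BE; exact: ((pf i).2 j u Uu).
have : \forall v \near u, [/\ U v, `|A u - A v| < e & `|B u - B v| < e].
  near=> v; split; near: v.
  - exact: open_nbhs_nbhs.
  - by move/cvgrPdist_lt : cA; exact.
  - by move/cvgrPdist_lt : cB; exact.
move=> /nbhs_normP[d /= d0 dP].
pose a : 'rV[R]_n := delta_mx 0 i; pose b : 'rV[R]_n := delta_mx 0 j.
(* Every point of the square of side [h] then lies within h(|a| + |b|) < d of [u]; the summand 1
   makes the denominator positive and the inequality strict. *)
pose h := d / (`|a| + `|b| + 1).
have ab0 : 0 < `|a| + `|b| + 1 by rewrite ltr_wpDl// addr_ge0.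
have h0 : 0 < h by rewrite divr_gt0.
have near_u v w s t : `|v| + `|w| = `|a| + `|b| ->
    s \in `[0, h] -> t \in `[0, h] ->
    [/\ U (u + s *: v + t *: w), `|A u - A (u + s *: v + t *: w)| < e
      & `|B u - B (u + s *: v + t *: w)| < e].
  rewrite !in_itv /= => vw /andP[s0 sh] /andP[t0 th]; apply: dP.
  rewrite /= -addrA opprD addrA subrr add0r normrN.
  rewrite (le_lt_trans (ler_normD _ _))// !normrZ !ger0_norm//.
  rewrite (@le_lt_trans _ _ (h * (`|v| + `|w|)))//.
    by rewrite mulrDr lerD// ler_wpM2r.
  by rewrite vw -[ltRHS](divfK (lt0r_neq0 ab0)) ltr_pM2l// ltrDl.
have derf (v w : 'rV[R]_n) k l : v = delta_mx 0 k -> w = delta_mx 0 l ->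
   `|v| + `|w| = `|a| + `|b| -> forall s t,
    s \in `[0, h] -> t \in `[0, h] ->
    derivable f (u + s *: v + t *: w) v /\
    derivable ('D_v f) (u + s *: v + t *: w) w.
  move=> -> -> vw s t sh th; have [Uv _ _] := near_u _ _ _ _ vw sh th; split.
    exact/diff_derivable/df.
  by apply: diff_derivable; have [+ _] := pf k; exact.
have [s [t [sh th E1]]] : exists s t, [/\ s \in `[0, h], t \in `[0, h] &
    f (u + h *: a + h *: b) - f (u + h *: a) - f (u + h *: b) + f u =
    h ^+ 2 * B (u + s *: a + t *: b)].
  rewrite BE.
  exact: second_difference (ltW h0) (derf a b i j erefl erefl erefl).
have [s' [t' [sh' th' E2]]] : exists s t, [/\ s \in `[0, h], t \in `[0, h] &
    f (u + h *: b + h *: a) - f (u + h *: b) - f (u + h *: a) + f u =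
    h ^+ 2 * A (u + s *: b + t *: a)].
  rewrite AE.
  exact: second_difference (ltW h0) (derf b a j i erefl erefl (addrC _ _)).
have [_ _ Bb] := near_u a b s t erefl sh th.
have [_ Aa _] := near_u b a s' t' (addrC _ _) sh' th'.
have AB : A (u + s' *: b + t' *: a) = B (u + s *: a + t *: b).
  have h2 : h ^+ 2 != 0 by rewrite expf_neq0 ?gt_eqF.
  apply: (mulfI h2); rewrite -E2 -E1 [u + h *: b + _]addrAC; ring.
have : `|A u - B u| < e + e.
  rewrite -[A u](subrK (A (u + s' *: b + t' *: a))) -addrA {2}AB.
  by rewrite (le_lt_trans (ler_normD _ _))// ltrD// distrC.
by rewrite /e -splitr ltxx.
Unshelve. all: by end_near. Qed.

End Schwarz.

(** * Charts, tangent vectors and vector fields *)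

Section Smooth_theory.
Context {R : realType} {n : nat}.
Implicit Types (U : set 'rV[R]_n) (f g : 'rV[R]_n -> R).

Lemma smooth_differentiable U f u : smooth U f -> U u -> differentiable f u.
Proof. by move=> /(_ 1%N)[df _]; exact: df. Qed.

Lemma smooth_partial U f i : smooth U f -> smooth U (partial i f).
Proof. by move=> sf k; have [_] := sf k.+1; exact. Qed.

Lemma partial_sum (I : Type) (r : seq I) (f : I -> 'rV[R]_n -> R) i u :
  (forall j, differentiable (f j) u) ->
  partial i (fun v => \sum_(j <- r) f j v) u = \sum_(j <- r) partial i (f j) u.
Proof.
(* Differentiability of the partial sums is carried through the induction, since additivity of
   [partial] requires it of the tail. *)
move=> df; suff [] : differentiable (fun v => \sum_(j <- r) f j v) u /\
  partial i (fun v => \sum_(j <- r) f j v) u =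
    \sum_(j <- r) partial i (f j) u by [].
elim: r => [|j r [ds IH]].
  have -> : (fun v => \sum_(j <- [::]) f j v) = cst 0.
    by apply/funext => v; rewrite big_nil.
  by rewrite big_nil; split; [exact: differentiable_cst|exact: derive_cst].
have -> : (fun v => \sum_(l <- j :: r) f l v) =
    (fun v => f j v + \sum_(l <- r) f l v).
  by apply/funext => v; rewrite big_cons.
by rewrite big_cons partialD// IH; split => //; exact: differentiableD.
Qed.

Lemma partial_coord (i j : 'I_n) (u : 'rV[R]_n) :
  partial i (fun v => v 0 j) u = (i == j)%:R.
Proof.
have /matrixP /(_ 0 j) : 'D_(delta_mx 0 i) (@id 'rV[R]_n) u = delta_mx 0 i.
  exact: derive_id.
by rewrite derive_mx ?mxE ?eqxx/= 1?eq_sym//; exact: derivable_id.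
Qed.

End Smooth_theory.

Section Manifold_theory.
Context {R : realType} {n : nat} {M : manifold R n}.
Implicit Types (c : chart_index M) (p q : M) (W : set M) (f g : M -> R).
Implicit Types (X Y Z : tfield M).

Lemma open_Dom c : open (Dom c).
Proof. exact: dom_open. Qed.

Lemma ParamK c q : Dom c q -> Param c (Coord c q) = q.
Proof. exact: coordK. Qed.

(** Over the image of the chart, the image of [W] is also the preimage of [W] under [Param c], so
    continuity of [Param c] makes it open. *)
Lemma open_Coord_image c W : open W -> open (Coord c @` (W `&` Dom c)).
Proof.
move=> oW; have -> : Coord c @` (W `&` Dom c) =
    (Coord c @` Dom c) `&` (Param c @^-1` W).
  apply/seteqP; split => [_ [q [Wq cq] <-]|_ [[q cq <-]]] /=.
    by split; [exists q|rewrite ParamK].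
  by rewrite ParamK// => Wq; exists q.
rewrite openE => u [cu Wu]; apply: filterI.
  by apply: open_nbhs_nbhs; split => //; exact: image_open.
by apply: (param_continuous cu); exact: open_nbhs_nbhs.
Qed.

Lemma smooth_on_cst W (a : R) : smooth_on W (cst a).
Proof. by move=> c k; exact: Ck_cst. Qed.

Lemma transition_smooth c c' W j : W `<=` Dom c' ->
  smooth (Coord c @` (W `&` Dom c)) (fun u => Coord c' (Param c u) 0 j).
Proof.
move=> Wc' k; apply: Ck_sub (@atlas_smooth _ _ M c c' j k).
by apply: image_subset => q [/Wc'].
Qed.

(** In any other chart, [f] is its expression in [c] composed with a smooth transition map.
    Smoothness may thus be checked in a single chart that contains [W]. *)
Lemma smooth_on_chart c W f : open W -> W `<=` Dom c ->
  smooth (Coord c @` (W `&` Dom c)) (f \o Param c) -> smooth_on W f.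
Proof.
move=> oW Wc sf c' k; have oU := @open_Coord_image c' _ oW.
have : Ck k (Coord c' @` (W `&` Dom c'))
    ((f \o Param c) \o (Coord c \o Param c')).
  apply: Ck_comp (sf k) => //.
    move=> _ [q [Wq c'q] <-] /=; rewrite ParamK//.
    by exists q => //; split => //; exact: Wc.
  by move=> j; exact: transition_smooth.
apply: Ck_ext => // u; rewrite inE => -[q [Wq c'q] <-] /=.
by rewrite (ParamK c'q) ParamK//; exact: Wc.
Qed.

Lemma differentiable_chart c W f q : smooth_on W f -> W q -> Dom c q ->
  differentiable (f \o Param c) (Coord c q).
Proof. by move=> sf Wq cq; apply: smooth_differentiable (sf c) _; exists q. Qed.

Lemma partial_chart_ext c W f g i q :
  open W -> {in W, f =1 g} -> W q -> Dom c q ->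
  partial i (f \o Param c) (Coord c q) = partial i (g \o Param c) (Coord c q).
Proof.
move=> oW fg Wq cq; apply: (partial_ext i (@open_Coord_image c _ oW)).
  move=> u; rewrite inE => -[r [Wr cr] <-] /=; rewrite ParamK//.
  by apply: fg; rewrite inE.
by exists q.
Qed.

(** The chain rule for the transition map. It is the source of the cocycle law of the Jacobians and
    of the chart independence of derivations. *)
Lemma partial_change_chart c c' f i q : Dom c q -> Dom c' q ->
  differentiable (f \o Param c') (Coord c' q) ->
  partial i (f \o Param c) (Coord c q) =
  \sum_(j < n) jac c c' q i j * partial j (f \o Param c') (Coord c' q).
Proof.
move=> cq c'q df.
have oU := @open_Coord_image c _ (open_Dom c').
have Uq : (Coord c @` (Dom c' `&` Dom c)) (Coord c q) by exists q.
rewrite (partial_ext (g := (f \o Param c') \o (Coord c' \o Param c)) i oU _ Uq);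
  last first.
  move=> u; rewrite inE => -[r [c'r cr] <-] /=.
  by rewrite (ParamK cr) ParamK.
rewrite partial_comp /=.
- by apply: eq_bigr => j _; rewrite mulrC ParamK// mxE.
- by move=> j; apply: smooth_differentiable Uq; exact: transition_smooth.
- by rewrite ParamK.
Qed.

Lemma jac_id c q : Dom c q -> jac c c q = 1%:M.
Proof.
move=> cq; apply/matrixP => i j; rewrite !mxE.
rewrite -(@partial_coord R n i j (Coord c q)).
apply: (partial_ext i (@open_Coord_image c _ (open_Dom c))); last by exists q.
by move=> u; rewrite inE => -[r [cr _] <-] /=; rewrite ParamK.
Qed.

Lemma jac_cocycle c c' c'' q : Dom c q -> Dom c' q -> Dom c'' q ->
  jac c c'' q = jac c c' q *m jac c' c'' q.
Proof.
move=> cq c'q c''q; apply/matrixP => i k; rewrite !mxE.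
rewrite (@partial_change_chart c c' (fun r => Coord c'' r 0 k))//.
  by apply: eq_bigr => j _; congr (_ * _); rewrite mxE.
apply: (@smooth_differentiable _ _ (Coord c' @` (Dom c'' `&` Dom c'))).
  exact: transition_smooth.
by exists q.
Qed.

Lemma jac_smooth c c' W i j : open W -> W `<=` Dom c -> W `<=` Dom c' ->
  smooth_on W (fun q => jac c c' q i j).
Proof.
move=> oW Wc Wc'; apply: (smooth_on_chart oW Wc) => k.
have := smooth_partial i (@transition_smooth c c' W j Wc') k.
apply: (Ck_ext (open_Coord_image oW)).
by move=> u; rewrite inE => -[q [Wq cq] <-] /=; rewrite mxE ParamK.
Qed.

Lemma tangentD p x y : tangent p x -> tangent p y -> tangent p (x + y).
Proof.
move=> [tx x0] [ty y0]; split=> [c c' cp c'p|c cp].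
  by rewrite !fctE (tx c c')// (ty c c')// mulmxDl.
by rewrite fctE x0// y0// addr0.
Qed.

Lemma tangentZ p (a : R) x : tangent p x -> tangent p (a *: x).
Proof.
move=> [tx x0]; split=> [c c' cp c'p|c cp].
  by rewrite !fctE (tx c c')// scalemxAl.
by rewrite fctE x0// scaler0.
Qed.

Lemma tangentN p x : tangent p x -> tangent p (- x).
Proof. by rewrite -scaleN1r; exact: tangentZ. Qed.

Lemma tangent0 p : tangent p 0.
Proof. by split=> // c c' _ _; rewrite mul0mx. Qed.

Lemma tangent_sum p (I : Type) (r : seq I)
    (x : I -> chart_index M -> 'rV[R]_n) :
  (forall i, tangent p (x i)) -> tangent p (\sum_(i <- r) x i).
Proof.
by move=> tx; elim/big_ind : _ => //;
  [exact: tangent0|move=> ? ?; exact: tangentD].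
Qed.

Lemma tangent_dd c i q : Dom c q -> tangent q (dd c i q).
Proof.
move=> cq; split=> [c1 c2 c1q c2q|c' c'q]; rewrite /dd.
  rewrite !asboolT// -row_mul; congr (row i _); exact: jac_cocycle.
by rewrite asboolF// => -[].
Qed.

Lemma tangent_expand c q x : Dom c q -> tangent q x ->
  x = \sum_(i < n) x c 0 i *: dd c i q.
Proof.
move=> cq [tx x0]; apply/funext => c'; rewrite fct_sumE.
have [c'q|c'q] := pselect (Dom c' q); last first.
  by rewrite x0// big1// => i _; rewrite /dd fctE asboolF ?scaler0// => -[].
rewrite (tx c)// mulmx_sum_row; apply: eq_bigr => i _.
by rewrite !fctE /dd asboolT.
Qed.

Lemma dd_self c i j q : Dom c q -> dd c i q c 0 j = (i == j)%:R.
Proof. by move=> cq; rewrite /dd asboolT// jac_id// !mxE. Qed.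

Lemma vfield_sub W W' X : W' `<=` W -> vfield W X -> vfield W' X.
Proof.
move=> sW [tX sX]; split=> [q /sW/tX//|c i k]; apply: Ck_sub (sX c i k).
by apply: image_subset => q [/sW].
Qed.

Lemma vfield_ext W X Y : open W -> {in W, X =1 Y} -> vfield W X -> vfield W Y.
Proof.
move=> oW XY [tX sX]; split=> [q Wq|c i k].
  by rewrite -XY ?inE//; exact: tX.
apply: Ck_ext (sX c i k); first exact: open_Coord_image.
by move=> u; rewrite inE => -[q [Wq cq] <-]; rewrite ParamK// XY ?inE.
Qed.

Lemma vfieldD W X Y : open W -> vfield W X -> vfield W Y -> vfield W (X + Y).
Proof.
move=> oW [tX sX] [tY sY]; split=> [q Wq|c i k].
  by apply: tangentD; [exact: tX|exact: tY].
apply: Ck_ext (CkD (@open_Coord_image c _ oW) (sX c i k) (sY c i k)).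
  exact: open_Coord_image.
by move=> u _; rewrite !fctE mxE.
Qed.

Lemma vfield_fscale W f X : open W -> smooth_on W f -> vfield W X ->
  vfield W (fscale f X).
Proof.
move=> oW sf [tX sX]; split=> [q Wq|c i k].
  by apply: tangentZ; exact: tX.
apply: Ck_ext (CkM (@open_Coord_image c _ oW) (sf c k) (sX c i k)).
  exact: open_Coord_image.
by move=> u _; rewrite /fscale /= !fctE mxE.
Qed.

Lemma vfieldN W X : open W -> vfield W X -> vfield W (- X).
Proof.
move=> oW vX.
apply: vfield_ext oW _ (vfield_fscale oW (smooth_on_cst W (-1)) vX).
by move=> q _; rewrite /fscale /= scaleN1r.
Qed.

Lemma vfieldB W X Y : open W -> vfield W X -> vfield W Y -> vfield W (X - Y).
Proof. by move=> oW vX vY; apply: vfieldD => //; exact: vfieldN. Qed.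

Lemma vfield0 W : vfield W (0 : tfield M).
Proof.
split=> [q _|c i k]; first exact: tangent0.
rewrite (_ : (fun _ => _) = cst 0); first exact: Ck_cst.
by apply/funext => u; rewrite mxE.
Qed.

Lemma vfield_sum W (I : Type) (r : seq I) (X : I -> tfield M) : open W ->
  (forall i, vfield W (X i)) -> vfield W (\sum_(i <- r) X i).
Proof.
move=> oW vX; elim/big_ind : _ => //; first exact: vfield0.
by move=> ? ?; exact: vfieldD.
Qed.

Lemma vfield_dd c i W : open W -> W `<=` Dom c -> vfield W (dd c i).
Proof.
move=> oW Wc; split=> [q /Wc|c' j k]; first exact: tangent_dd.
have oW' : open (W `&` Dom c') by apply: openI => //; exact: open_Dom.
have := @jac_smooth c c' _ i j oW' (fun q h => Wc q h.1) (fun q h => h.2) c' k.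
rewrite -setIA setIid; apply: (Ck_ext (open_Coord_image oW)).
move=> u; rewrite inE => -[q [Wq c'q] <-] /=.
rewrite ParamK// /dd asboolT; first by rewrite [RHS]mxE.
by split=> //; exact: Wc.
Qed.

Lemma vfield_coef c W X i : open W -> W `<=` Dom c -> vfield W X ->
  smooth_on W (fun q => X q c 0 i).
Proof. by move=> oW Wc [_ sX]; apply: (smooth_on_chart oW Wc); exact: sX. Qed.

Lemma vfield_expand c W X : W `<=` Dom c -> vfield W X ->
  {in W, X =1 \sum_(i < n) fscale (fun q => X q c 0 i) (dd c i)}.
Proof.
move=> Wc [tX _] q; rewrite inE => Wq.
by rewrite [LHS](tangent_expand (Wc q Wq) (tX q Wq)) [X in _ = X q]fct_sumE.
Qed.

(** The same matrix [jac c' c] carries the components of [X] from [c'] to [c] and expresses the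
    partial derivatives in [c'] through those in [c]; exchanging the two sums matches them. *)
Lemma deriv_alongE c W X f q : smooth_on W f -> W q -> Dom c q ->
  tangent q (X q) -> deriv_along X f q = dir c X f q.
Proof.
move=> sf Wq cq [tX _]; rewrite /deriv_along /dir; set c' := chart_at q.
have c'q : Dom c' q by rewrite /c' /chart_at; case: cid.
have df := differentiable_chart sf Wq cq.
under eq_bigr do rewrite (partial_change_chart _ c'q cq df) mulr_sumr.
rewrite exchange_big /=; apply: eq_bigr => j _.
rewrite (tX c' c)// mxE mulr_suml; apply: eq_bigr => i _.
by rewrite mulrA.
Qed.

Lemma deriv_along_ext W X f g q : open W -> {in W, f =1 g} -> W q ->
  deriv_along X f q = deriv_along X g q.
Proof.
move=> oW fg Wq; apply: eq_bigr => i _; congr (_ * _).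
by apply: partial_chart_ext oW fg Wq _; rewrite /chart_at; case: cid.
Qed.

Lemma deriv_alongD W X f g q : smooth_on W f -> smooth_on W g -> W q ->
  deriv_along X (fun r => f r + g r) q = deriv_along X f q + deriv_along X g q.
Proof.
move=> sf sg Wq; rewrite /deriv_along /dir; set c := chart_at q.
have cq : Dom c q by rewrite /c /chart_at; case: cid.
rewrite -big_split; apply: eq_bigr => i _ /=; rewrite -mulrDr; congr (_ * _).
by rewrite -partialD//; exact: differentiable_chart.
Qed.

Lemma deriv_along_smooth W X f : open W -> vfield W X -> smooth_on W f ->
  smooth_on W (deriv_along X f).
Proof.
move=> oW [tX sX] sf c k; have oU := @open_Coord_image c _ oW.
have : Ck k (Coord c @` (W `&` Dom c))
    (fun u => \sum_(i < n) X (Param c u) c 0 i * partial i (f \o Param c) u).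
  apply: Ck_sum => // i; apply: CkM => //; first exact: sX.
  exact: (smooth_partial i (sf c)).
apply: Ck_ext => // u; rewrite inE => -[q [Wq cq] <-] /=.
rewrite (ParamK cq) (deriv_alongE sf Wq cq)//; exact: tX.
Qed.

(** Each iterated derivative is a second-order sum [S] plus first-order terms. [S] is symmetric in
    the two fields by [partialC] and disappears from the difference; the remaining coefficients are
    those defining [lie]. *)
Lemma deriv_along_lie W X Y f q : open W -> vfield W X -> vfield W Y ->
  smooth_on W f -> W q ->
  deriv_along X (deriv_along Y f) q - deriv_along Y (deriv_along X f) q =
  deriv_along (lie X Y) f q.
Proof.
move=> oW vX vY sf Wq; set c := chart_at q.
have cq : Dom c q by rewrite /c /chart_at; case: cid.
pose U := Coord c @` (W `&` Dom c).
have oU : open U := @open_Coord_image c _ oW.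
have Uq : U (Coord c q) by exists q.
pose F := f \o Param c.
have dF i : differentiable (partial i F) (Coord c q).
  exact: smooth_differentiable (smooth_partial i (sf c)) Uq.
pose S X' Y' := \sum_(i < n) \sum_(j < n)
  X' q c 0 i * Y' q c 0 j * partial i (partial j F) (Coord c q).
have SC : S X Y = S Y X.
  rewrite /S exchange_big; apply: eq_bigr => j _; apply: eq_bigr => i _ /=.
  rewrite (partialC i j oU (sf c 2%N) Uq); congr (_ * _); exact: mulrC.
have second X' Y' : vfield W X' -> vfield W Y' ->
  deriv_along X' (deriv_along Y' f) q = S X' Y' + \sum_(j < n)
    dir c X' (fun r => Y' r c 0 j) q * partial j F (Coord c q).
  move=> [tX' sX'] [tY' sY'].
  transitivity (dir c X' (deriv_along Y' f) q) => //.
  have -> :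
      \sum_(j < n) dir c X' (fun r => Y' r c 0 j) q * partial j F (Coord c q)
      = \sum_(i < n) \sum_(j < n) X' q c 0 i *
        partial i (fun u => Y' (Param c u) c 0 j) (Coord c q) *
        partial j F (Coord c q).
    by rewrite exchange_big; apply: eq_bigr => j _; rewrite mulr_suml.
  rewrite /S -big_split; apply: eq_bigr => i _ /=; rewrite -big_split /=.
  have dY j : differentiable (fun u => Y' (Param c u) c 0 j) (Coord c q).
    exact: smooth_differentiable (sY' c j) Uq.
  rewrite (partial_ext (g := fun u => \sum_(j < n)
      Y' (Param c u) c 0 j * partial j F u) i oU _ Uq); last first.
    move=> u; rewrite inE => -[r [Wr cr] <-] /=.
    by rewrite (ParamK cr) (deriv_alongE sf Wr cr)//; exact: tY'.
  rewrite partial_sum; last by move=> j; exact: differentiableM.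
  rewrite mulr_sumr; apply: eq_bigr => j _.
  rewrite partialM// mulrDr ParamK// mulrA; congr (_ + _); ring.
rewrite !second// SC opprD addrACA subrr add0r.
rewrite [RHS]/deriv_along -/c /dir -sumrB.
by apply: eq_bigr => j _; rewrite -mulrBl /lie asboolT// mxE.
Qed.

End Manifold_theory.

(** * The metric and the curvature tensor *)

Section Metric.
Context {R : realType} {n : nat} {M : riemannian R n}.
Implicit Types (p : M) (x y z : chart_index M -> 'rV[R]_n).

Lemma metricDl p x y z : tangent p x -> tangent p y -> tangent p z ->
  metric p (x + y) z = metric p x z + metric p y z.
Proof. by move=> tx ty tz; rewrite -{1}(scale1r x) metric_linear// mul1r. Qed.

Lemma metric0l p z : tangent p z -> metric p 0 z = 0.
Proof.
move=> tz; apply: (addrI (metric p 0 z)).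
by rewrite addr0 -metricDl ?addr0//; exact: tangent0.
Qed.

Lemma metricZl p (a : R) x z : tangent p x -> tangent p z ->
  metric p (a *: x) z = a * metric p x z.
Proof.
move=> tx tz; rewrite -[a *: x]addr0 metric_linear ?metric0l ?addr0//.
exact: tangent0.
Qed.

Lemma metricBl p x y z : tangent p x -> tangent p y -> tangent p z ->
  metric p (x - y) z = metric p x z - metric p y z.
Proof.
move=> tx ty tz; rewrite -scaleN1r metricDl ?metricZl ?mulN1r//.
exact: tangentZ.
Qed.

Lemma metricDr p x y z : tangent p x -> tangent p y -> tangent p z ->
  metric p z (x + y) = metric p z x + metric p z y.
Proof.
move=> tx ty tz; rewrite Defs.metric_sym ?metricDl//; last exact: tangentD.
by congr (_ + _); exact: Defs.metric_sym.
Qed.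

Lemma metricZr p (a : R) x z : tangent p x -> tangent p z ->
  metric p z (a *: x) = a * metric p z x.
Proof.
move=> tx tz; rewrite Defs.metric_sym ?metricZl//; last exact: tangentZ.
by congr (_ * _); exact: Defs.metric_sym.
Qed.

Lemma metricBr p x y z : tangent p x -> tangent p y -> tangent p z ->
  metric p z (x - y) = metric p z x - metric p z y.
Proof.
move=> tx ty tz; rewrite -scaleN1r metricDr ?metricZr ?mulN1r//.
exact: tangentZ.
Qed.

Lemma metric_suml p (I : Type) (r : seq I)
    (x : I -> chart_index M -> 'rV[R]_n) z :
  (forall i, tangent p (x i)) -> tangent p z ->
  metric p (\sum_(i <- r) x i) z = \sum_(i <- r) metric p (x i) z.
Proof.
move=> tx tz; elim: r => [|i r IH]; first by rewrite !big_nil metric0l.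
by rewrite !big_cons metricDl ?IH//; exact: tangent_sum.
Qed.

Lemma metric_nondegenerate p x : tangent p x ->
  (forall z, tangent p z -> metric p x z = 0) -> x = 0.
Proof.
move=> tx x0; apply/eqP/negPn/negP => xn0.
by have := metric_pos tx xn0; rewrite x0// ltxx.
Qed.

End Metric.

(** * Tensoriality and metric skewness of the curvature *)

Section Curvature.
Context {R : realType} {n : nat} {M : riemannian R n}.
Context {D : tfield M -> tfield M -> tfield M} (HD : levi_civita D).
Context {W : set M} (oW : open W).
Implicit Types (X Y Z : tfield M) (q : M).
Let C : connection D := lc_connection HD.

Let vD X Y : vfield W X -> vfield W Y -> vfield W (D X Y).
Proof. exact: conn_vfield. Qed.

Let tvf X q : vfield W X -> W q -> tangent q (X q).
Proof. by move=> [tX _] /tX. Qed.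

Lemma nabla_ext X X' Y Y' q : vfield W X -> vfield W Y ->
  {in W, X =1 X'} -> {in W, Y =1 Y'} -> W q -> D X Y q = D X' Y' q.
Proof.
move=> vX vY XX' YY' Wq; apply: (conn_local C oW) => //; last by rewrite inE.
- exact: vfield_ext vX.
- exact: vfield_ext vY.
Qed.

Lemma nablaDl X X' Y q : vfield W X -> vfield W X' -> vfield W Y -> W q ->
  D (X + X') Y q = D X Y q + D X' Y q.
Proof. by move=> vX vX' vY Wq; rewrite (conn_addl C oW)// inE. Qed.

Lemma nablaDr X Y Y' q : vfield W X -> vfield W Y -> vfield W Y' -> W q ->
  D X (Y + Y') q = D X Y q + D X Y' q.
Proof. by move=> vX vX' vY Wq; rewrite (conn_addr C oW)// inE. Qed.

Lemma nablaZl f X Y q : smooth_on W f -> vfield W X -> vfield W Y -> W q ->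
  D (fscale f X) Y q = f q *: D X Y q.
Proof. by move=> sf vX vY Wq; rewrite (conn_scalel C oW)// inE. Qed.

Lemma nablaZr f X Y q : smooth_on W f -> vfield W X -> vfield W Y -> W q ->
  D X (fscale f Y) q = deriv_along X f q *: Y q + f q *: D X Y q.
Proof. by move=> sf vX vY Wq; rewrite (conn_leibniz C oW)// inE. Qed.

Lemma nabla0l Y q : vfield W Y -> W q -> D 0 Y q = 0.
Proof.
move=> vY Wq; apply: (addrI (D 0 Y q)).
by rewrite addr0 -nablaDl ?addr0//; exact: vfield0.
Qed.

Lemma nablaNl X Y q : vfield W X -> vfield W Y -> W q ->
  D (- X) Y q = - D X Y q.
Proof.
move=> vX vY Wq; apply: (addrI (D X Y q)).
by rewrite subrr -nablaDl ?subrr ?nabla0l//; exact: vfieldN.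
Qed.

(* Torsion-freeness exhibits the bracket as a difference of covariant
   derivatives, so that neither its smoothness nor its transformation law has
   to be computed. *)
Lemma vfield_lie X Y : vfield W X -> vfield W Y -> vfield W (lie X Y).
Proof.
move=> vX vY; apply: vfield_ext oW (lc_torsion_free HD oW vX vY) _.
by apply: vfieldB => //; exact: vD.
Qed.

Let nabla_lie X Y Z q : vfield W X -> vfield W Y -> vfield W Z -> W q ->
  D (lie X Y) Z q = D (D X Y) Z q - D (D Y X) Z q.
Proof.
move=> vX vY vZ Wq; have [vXY vYX] := (vD vX vY, vD vY vX).
rewrite -nablaNl// -nablaDl//; last exact: vfieldN.
apply: nabla_ext Wq => //; first exact: vfield_lie.
by move=> r Wr; rewrite (lc_torsion_free HD oW vX vY Wr).
Qed.

(** Torsion-freeness eliminates the bracket and leaves an expression in [D] alone, to which the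
    connection axioms apply directly. *)
Let curvE X Y Z q : vfield W X -> vfield W Y -> vfield W Z -> W q ->
  curv D X Y Z q = D X (D Y Z) q - D Y (D X Z) q
                   - (D (D X Y) Z q - D (D Y X) Z q).
Proof. by move=> vX vY vZ Wq; rewrite -nabla_lie. Qed.

Lemma vfield_curv X Y Z : vfield W X -> vfield W Y -> vfield W Z ->
  vfield W (curv D X Y Z).
Proof.
move=> vX vY vZ; have vl := vfield_lie vX vY.
by apply: vfieldB; [|apply: vfieldB|]; do ?apply: vD.
Qed.

Lemma curv_ext X X' Y Y' Z Z' q : vfield W X -> vfield W Y -> vfield W Z ->
  {in W, X =1 X'} -> {in W, Y =1 Y'} -> {in W, Z =1 Z'} -> W q ->
  curv D X Y Z q = curv D X' Y' Z' q.
Proof.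
move=> vX vY vZ XX' YY' ZZ' Wq.
have [vX' vY' vZ'] :
  [/\ vfield W X', vfield W Y' & vfield W Z'].
  by split; [exact: vfield_ext vX|exact: vfield_ext vY|exact: vfield_ext vZ].
have DW U U' V V' : vfield W U -> vfield W V ->
    {in W, U =1 U'} -> {in W, V =1 V'} -> {in W, D U V =1 D U' V'}.
  by move=> vU vV UU' VV' r; rewrite inE => Wr; apply: nabla_ext Wr.
have Wq' : q \in W by rewrite inE.
rewrite !curvE//; congr (_ - _ - (_ - _)); apply: (DW _ _ _ _) Wq' => //;
  do ?[exact: vD]; exact: DW.
Qed.

Let components_ext (u v : chart_index M -> 'rV[R]_n) :
  (forall c' i, u c' 0 i = v c' 0 i) -> u = v.
Proof. by move=> uv; apply/funext => c'; apply/rowP => i; exact: uv. Qed.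

Lemma curvC X Y Z q : vfield W X -> vfield W Y -> vfield W Z -> W q ->
  curv D Y X Z q = - curv D X Y Z q.
Proof.
move=> vX vY vZ Wq; rewrite !curvE//.
by apply: components_ext => c' i; rewrite !(fctE, mxE); ring.
Qed.

Lemma curvDl X X' Y Z q : vfield W X -> vfield W X' -> vfield W Y ->
  vfield W Z -> W q -> curv D (X + X') Y Z q = curv D X Y Z q + curv D X' Y Z q.
Proof.
move=> vX vX' vY vZ Wq; have vXX' := vfieldD oW vX vX'.
rewrite !curvE// nablaDl//; last exact: vD.
(* An identity inside an outer [D] is needed on all of [W], not just at [q], because the outer
   operator differentiates it. *)
rewrite (@nabla_ext Y Y (D (X + X') Z) (D X Z + D X' Z))//; last 2 first.
- exact: vD.
- by move=> r; rewrite inE => Wr; rewrite nablaDl.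
rewrite (@nabla_ext (D (X + X') Y) (D X Y + D X' Y) Z Z)//; last 2 first.
- exact: vD.
- by move=> r; rewrite inE => Wr; rewrite nablaDl.
rewrite (@nabla_ext (D Y (X + X')) (D Y X + D Y X') Z Z)//; last 2 first.
- exact: vD.
- by move=> r; rewrite inE => Wr; rewrite nablaDr.
rewrite nablaDr//; [|exact: vD|exact: vD].
rewrite !nablaDl//; do ?[exact: vD].
by apply: components_ext => c' i; rewrite !(fctE, mxE); ring.
Qed.

(** Two terms (Yf) D_X Z arise, one from differentiating [fscale f (D X Z)] along [Y], the other
    from D_Y(fX) in the bracket part; they cancel. *)
Lemma curvZl f X Y Z q : smooth_on W f -> vfield W X -> vfield W Y ->
  vfield W Z -> W q -> curv D (fscale f X) Y Z q = f q *: curv D X Y Z q.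
Proof.
move=> sf vX vY vZ Wq; have vfX := vfield_fscale oW sf vX.
have sYf := deriv_along_smooth oW vY sf.
rewrite !curvE// nablaZl//; last exact: vD.
rewrite (@nabla_ext Y Y (D (fscale f X) Z) (fscale f (D X Z)))//; last 2 first.
- exact: vD.
- by move=> r; rewrite inE => Wr; rewrite nablaZl.
rewrite (@nabla_ext (D (fscale f X) Y) (fscale f (D X Y)) Z Z)//; last 2 first.
- exact: vD.
- by move=> r; rewrite inE => Wr; rewrite nablaZl.
rewrite (@nabla_ext (D Y (fscale f X))
  (fscale (deriv_along Y f) X + fscale f (D Y X)) Z Z)//; last 2 first.
- exact: vD.
- by move=> r; rewrite inE => Wr; rewrite nablaZr.
rewrite nablaZr//; last exact: vD.
rewrite nablaZl//; last exact: vD.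
rewrite nablaDl//; last 2 first.
- exact: vfield_fscale.
- by apply: vfield_fscale => //; exact: vD.
rewrite !nablaZl//; last exact: vD.
by apply: components_ext => c' i; rewrite !(fctE, mxE); ring.
Qed.

Lemma curvDr X Y Z Z' q : vfield W X -> vfield W Y -> vfield W Z ->
  vfield W Z' -> W q ->
  curv D X Y (Z + Z') q = curv D X Y Z q + curv D X Y Z' q.
Proof.
move=> vX vY vZ vZ' Wq; have vZZ' := vfieldD oW vZ vZ'.
rewrite !curvE//.
rewrite (@nabla_ext X X (D Y (Z + Z')) (D Y Z + D Y Z'))//; last 2 first.
- exact: vD.
- by move=> r; rewrite inE => Wr; rewrite nablaDr.
rewrite (@nabla_ext Y Y (D X (Z + Z')) (D X Z + D X Z'))//; last 2 first.
- exact: vD.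
- by move=> r; rewrite inE => Wr; rewrite nablaDr.
rewrite !nablaDr//; do ?[exact: vD].
by apply: components_ext => c' i; rewrite !(fctE, mxE); ring.
Qed.

Let second_leibniz f X Y Z q : smooth_on W f -> vfield W X -> vfield W Y ->
  vfield W Z -> W q ->
  D X (D Y (fscale f Z)) q = deriv_along X (deriv_along Y f) q *: Z q
    + deriv_along Y f q *: D X Z q
    + (deriv_along X f q *: D Y Z q + f q *: D X (D Y Z) q).
Proof.
move=> sf vX vY vZ Wq; have vfZ := vfield_fscale oW sf vZ.
have sYf := deriv_along_smooth oW vY sf; have vYZ := vD vY vZ.
rewrite (@nabla_ext X X (D Y (fscale f Z))
  (fscale (deriv_along Y f) Z + fscale f (D Y Z)))//; last 2 first.
- exact: vD.
- by move=> r; rewrite inE => Wr; rewrite nablaZr.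
by rewrite nablaDr// ?nablaZr//; exact: vfield_fscale.
Qed.

(** The terms with one derivative of [f] and one of [Z] are symmetric in [X] and [Y]. The second
    derivatives of [f] leave the commutator of [X] and [Y] on [f], which the bracket term cancels;
    so the bracket is kept here. *)
Lemma curvZr f X Y Z q : smooth_on W f -> vfield W X -> vfield W Y ->
  vfield W Z -> W q -> curv D X Y (fscale f Z) q = f q *: curv D X Y Z q.
Proof.
move=> sf vX vY vZ Wq; have vl := vfield_lie vX vY.
rewrite /curv !fctE !second_leibniz// nablaZr//.
rewrite -(deriv_along_lie oW vX vY sf Wq).
by apply: components_ext => c' i; rewrite !(fctE, mxE); ring.
Qed.

(* Differentiate <Z, Z'> twice: the commutator of X and Y minus the
   derivative along [X, Y] vanishes on functions. *)
Lemma curv_skew X Y Z Z' q : vfield W X -> vfield W Y -> vfield W Z ->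
  vfield W Z' -> W q ->
  metric q (curv D X Y Z q) (Z' q) = - metric q (Z q) (curv D X Y Z' q).
Proof.
move=> vX vY vZ vZ' Wq; have vl := vfield_lie vX vY.
(* The two mixed terms together are symmetric in [U] and [V], so they drop out of the commutator. *)
have second U V : vfield W U -> vfield W V ->
  deriv_along U (deriv_along V (fun r => metric r (Z r) (Z' r))) q =
  metric q (D U (D V Z) q) (Z' q) + metric q (D V Z q) (D U Z' q) +
  (metric q (D U Z q) (D V Z' q) + metric q (Z q) (D U (D V Z') q)).
  move=> vU vV; have [vVZ vVZ'] := (vD vV vZ, vD vV vZ').
  rewrite (deriv_along_ext U oW (lc_metric HD oW vV vZ vZ') Wq).
  rewrite (deriv_alongD U _ _ Wq); do ?exact: metric_smooth.
  by rewrite !(lc_metric HD oW)// inE.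
have := deriv_along_lie oW vX vY (metric_smooth oW vZ vZ') Wq.
rewrite !second// (lc_metric HD oW)//; last by rewrite inE.
have [vXYZ vYXZ] := (vD vX (vD vY vZ), vD vY (vD vX vZ)).
have [vXYZ' vYXZ'] := (vD vX (vD vY vZ'), vD vY (vD vX vZ')).
have [vlZ vlZ'] := (vD vl vZ, vD vl vZ').
have tB u v : tangent q u -> tangent q v -> tangent q (u - v).
  by move=> tu tv; apply: tangentD => //; exact: tangentN.
rewrite /curv !fctE !metricBl ?metricBr//; do ?[exact: tvf];
  do ?[by apply: tB; exact: tvf]; lra.
Qed.

(** On [W] the frame [dd c i] has smooth coefficient functions for [X], and linearity over functions
    pulls each of them out as its value at [p]. The operator [T] is abstract so that it can stand
    for any of the three slots of the curvature. *)
Lemma tensor_expand (V : lmodType R) (T : tfield M -> V) c p X :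
  W `<=` Dom c -> W p ->
  (forall X X', vfield W X -> {in W, X =1 X'} -> T X = T X') ->
  (forall X X', vfield W X -> vfield W X' -> T (X + X') = T X + T X') ->
  (forall f X, smooth_on W f -> vfield W X -> T (fscale f X) = f p *: T X) ->
  vfield W X -> T X = \sum_(i < n) X p c 0 i *: T (dd c i).
Proof.
move=> Wc Wp Text TD TZ vX.
have vdd i : vfield W (dd c i) by exact: vfield_dd.
have T0 : T 0 = 0.
  by apply: (addrI (T 0)); rewrite -TD ?addr0//; exact: vfield0.
rewrite (Text _ _ vX (vfield_expand Wc vX)).
have vs i : vfield W (fscale (fun q => X q c 0 i) (dd c i)).
  by apply: vfield_fscale => //; exact: vfield_coef.
elim: (index_enum _) => [|i r IH]; first by rewrite !big_nil.
rewrite !big_cons TD//; last exact: vfield_sum.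
by rewrite IH TZ//; exact: vfield_coef.
Qed.

Lemma curv_expand c p X Y Z : W `<=` Dom c -> W p ->
  vfield W X -> vfield W Y -> vfield W Z ->
  curv D X Y Z p = \sum_(i < n) \sum_(j < n) \sum_(k < n)
    (X p c 0 i * Y p c 0 j * Z p c 0 k) *: curv D (dd c i) (dd c j) (dd c k) p.
Proof.
move=> Wc Wp vX vY vZ; have vdd i : vfield W (dd c i) by exact: vfield_dd.
pose T1 X' := curv D X' Y Z p; rewrite -/(T1 X).
rewrite (tensor_expand (T := T1) Wc Wp _ _ _ vX); first last.
- by move=> f X' sf vX'; exact: curvZl.
- by move=> X' X'' vX' vX''; exact: curvDl.
- by move=> X' X'' vX' E; apply: curv_ext Wp.
apply: eq_bigr => i _; pose T2 Y' := curv D (dd c i) Y' Z p.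
rewrite -[T1 _]/(T2 Y).
(* Linearity in the second slot is reduced to the first by exchanging the two fields. *)
have T2N Y' : vfield W Y' -> T2 Y' = - curv D Y' (dd c i) Z p.
  by move=> vY'; exact: curvC.
rewrite (tensor_expand (T := T2) Wc Wp _ _ _ vY); first last.
- move=> f X' sf vX'; rewrite !T2N//; last exact: vfield_fscale.
  by rewrite curvZl// scalerN.
- move=> X' X'' vX' vX''; rewrite !T2N//; last exact: vfieldD.
  by rewrite curvDl// opprD.
- by move=> X' X'' vX' E; apply: curv_ext Wp.
rewrite scaler_sumr; apply: eq_bigr => j _.
pose T3 Z' := curv D (dd c i) (dd c j) Z' p; rewrite -[T2 _]/(T3 Z).
rewrite (tensor_expand (T := T3) Wc Wp _ _ _ vZ); first last.
- by move=> f X' sf vX'; exact: curvZr.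
- by move=> X' X'' vX' vX''; exact: curvDr.
- by move=> X' X'' vX' E; apply: curv_ext Wp.
by rewrite !scaler_sumr; apply: eq_bigr => k _; rewrite !scalerA.
Qed.

End Curvature.

(** * The curvature tensor at a point and its components *)

Section Riemann_tensor.
Context {R : realType} {n : nat} {M : riemannian R n}.
Context {D : tfield M -> tfield M -> tfield M} (HD : levi_civita D).
Context {c : chart_index M} {p : M} (cp : Dom c p).
Implicit Types (x y z w : chart_index M -> 'rV[R]_n).

Definition riemann x y z : chart_index M -> 'rV[R]_n :=
  \sum_(i < n) \sum_(j < n) \sum_(k < n)
    (x c 0 i * y c 0 j * z c 0 k) *: curv D (dd c i) (dd c j) (dd c k) p.

(** [riemann_at] would hold of every [w] if the given vectors had no extension; constant
    coefficients in the frame of [c] provide one on all of [Dom c]. *)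
Definition const_field x : tfield M :=
  \sum_(i < n) fscale (cst (x c 0 i)) (dd c i).

Let vdd i : vfield (Dom c) (dd c i : tfield M).
Proof. by apply: vfield_dd => //; exact: open_Dom. Qed.

Lemma vfield_const_field x : vfield (Dom c) (const_field x).
Proof.
have oc := open_Dom c; apply: vfield_sum => // i; apply: vfield_fscale => //.
exact: smooth_on_cst.
Qed.

Lemma const_fieldE x : tangent p x -> const_field x p = x.
Proof.
by move=> tx; rewrite [RHS](tangent_expand cp tx) [X in X p = _]fct_sumE.
Qed.

Lemma riemann_atP x y z w : tangent p x -> tangent p y -> tangent p z ->
  riemann_at D p x y z w <-> riemann x y z = w.
Proof.
move=> tx ty tz; split=> [|<- W X Y Z oW Wp vX vY vZ Xp Yp Zp].
  move=> /(_ _ _ _ _ (open_Dom c) cp (vfield_const_field x)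
    (vfield_const_field y) (vfield_const_field z)
    (const_fieldE tx) (const_fieldE ty) (const_fieldE tz)) <-.
  have oc := open_Dom c; have cc : Dom c `<=` Dom c by [].
  rewrite (curv_expand HD oc cc cp); do ?[exact: vfield_const_field].
  by rewrite !const_fieldE.
have oWc : open (W `&` Dom c) by apply: openI => //; exact: open_Dom.
have sW : W `&` Dom c `<=` W by move=> q [].
have sc : W `&` Dom c `<=` Dom c by move=> q [].
rewrite (curv_expand HD oWc sc (conj Wp cp)) ?Xp ?Yp ?Zp//.
- exact: vfield_sub vX.
- exact: vfield_sub vY.
- exact: vfield_sub vZ.
Qed.

Let te i : tangent p (dd c i p).
Proof. exact: tangent_dd. Qed.

Let tcurv i j k : tangent p (curv D (dd c i) (dd c j) (dd c k) p).
Proof.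
by have [+ _] := vfield_curv HD (open_Dom c) (vdd i) (vdd j) (vdd k); exact.
Qed.

Lemma tangent_riemann x y z : tangent p (riemann x y z).
Proof.
by do 3! [apply: tangent_sum => ?]; apply: tangentZ; exact: tcurv.
Qed.

Lemma metric_coord x y : tangent p x -> tangent p y ->
  metric p x y = \sum_(i < n) \sum_(j < n) x c 0 i * y c 0 j * gij c p i j.
Proof.
move=> tx ty; rewrite {1}(tangent_expand cp tx) metric_suml//; last first.
  by move=> i; exact: tangentZ.
apply: eq_bigr => i _; rewrite metricZl// Defs.metric_sym//.
rewrite {1}(tangent_expand cp ty) metric_suml//; last first.
  by move=> j; exact: tangentZ.
rewrite mulr_sumr; apply: eq_bigr => j _.
by rewrite metricZl// Defs.metric_sym// mulrA mxE.
Qed.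

(** The index order [l k i j] follows the convention R(W,Z,X,Y) = <W, R(X,Y)Z>: the vector paired
    with the curvature comes first, the one acted on second. *)
Lemma metric_riemann x y z w : tangent p w ->
  metric p (riemann x y z) w =
  \sum_(i < n) \sum_(j < n) \sum_(k < n) \sum_(l < n)
    x c 0 i * y c 0 j * z c 0 k * w c 0 l * Rijkl D c p l k i j.
Proof.
move=> tw; rewrite /riemann metric_suml//; last first.
  by move=> i; do 2! [apply: tangent_sum => ?]; exact: tangentZ.
apply: eq_bigr => i _; rewrite metric_suml//; last first.
  by move=> j; apply: tangent_sum => ?; exact: tangentZ.
apply: eq_bigr => j _; rewrite metric_suml//; last by move=> k; exact: tangentZ.
apply: eq_bigr => k _; rewrite metricZl// Defs.metric_sym//.
rewrite {1}(tangent_expand cp tw) metric_suml//; last first.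
  by move=> l; exact: tangentZ.
rewrite mulr_sumr; apply: eq_bigr => l _.
by rewrite metricZl// mulrA.
Qed.

Lemma Rijkl_skewr i j k l : Rijkl D c p i j l k = - Rijkl D c p i j k l.
Proof.
rewrite /Rijkl (curvC HD (open_Dom c))// -scaleN1r metricZr ?mulN1r//.
Qed.

Lemma Rijkl_skewl i j k l : Rijkl D c p j i k l = - Rijkl D c p i j k l.
Proof.
rewrite /Rijkl Defs.metric_sym// (curv_skew HD (open_Dom c))//.
Qed.

Lemma gijC i j : gij c p j i = gij c p i j.
Proof. by rewrite !mxE Defs.metric_sym. Qed.

End Riemann_tensor.

(** * Dimension 2 *)

Lemma sum_ord2 (V : nmodType) (F : 'I_2 -> V) :
  \sum_(i < 2) F i = F ord0 + F ord_max.
Proof.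
by rewrite big_ord_recl big_ord1; congr (_ + F _); exact: val_inj.
Qed.

(** Write a^b for a_0 b_1 - a_1 b_0. Skewness reduces the fourfold sum to r_0101 (y^x)(w^x), and by
    Cauchy-Binet the Gram determinant on the right is det(g) (x^y)(x^w). Multiplying through by
    det(g) keeps the identity polynomial. *)
Lemma surface_identity (R : realFieldType) (g : 'I_2 -> 'I_2 -> R)
    (r : 'I_2 -> 'I_2 -> 'I_2 -> 'I_2 -> R) (x y w : 'I_2 -> R) :
  (forall i j, g j i = g i j) ->
  (forall i j k l, r j i k l = - r i j k l) ->
  (forall i j k l, r i j l k = - r i j k l) ->
  (g ord0 ord0 * g ord_max ord_max - g ord0 ord_max ^+ 2) *
    (\sum_(i < 2) \sum_(j < 2) \sum_(k < 2) \sum_(l < 2)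
       y i * x j * x k * w l * r l k i j) =
  r ord0 ord_max ord0 ord_max *
    ((\sum_(i < 2) \sum_(j < 2) x i * x j * g i j) *
       (\sum_(i < 2) \sum_(j < 2) y i * w j * g i j) -
     (\sum_(i < 2) \sum_(j < 2) x i * y j * g i j) *
       (\sum_(i < 2) \sum_(j < 2) x i * w j * g i j)).
Proof.
move=> gC rl rr.
have rl0 i k l : r i i k l = 0 by have := rl i i k l; lra.
have rr0 i j k : r i j k k = 0 by have := rr i j k k; lra.
(* The skewness rules are fixed at [ord0] and [ord_max], as the general ones would swap indices
   forever; every component becomes 0 or a signed copy of r_0101. *)
rewrite !sum_ord2 !rl0 !rr0 !(rl ord0 ord_max) !(rr _ _ ord0 ord_max).
rewrite (gC ord0 ord_max); ring.
Qed.

Section Surface.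
Context {R : realType} {M : riemannian R 2}.
Context {D : tfield M -> tfield M -> tfield M} (HD : levi_civita D).
Context {c : chart_index M} {p : M} (cp : Dom c p).
Implicit Types (x y z w : chart_index M -> 'rV[R]_2).

Let e0 := dd c ord0 p.
Let e1 := dd c ord_max p.
Let g00 := metric p e0 e0.
Let g01 := metric p e0 e1.
Let g11 := metric p e1 e1.
Let te0 : tangent p e0. Proof. exact: tangent_dd. Qed.
Let te1 : tangent p e1. Proof. exact: tangent_dd. Qed.

Let det_gijE : \det (gij c p) = g00 * g11 - g01 ^+ 2.
Proof.
rewrite (expand_det_row _ ord0) sum_ord2 /cofactor !det_mx11 !mxE /=.
rewrite (_ : lift _ _ = ord_max); last exact: val_inj.
rewrite (_ : lift _ _ = ord0); last exact: val_inj.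
rewrite (Defs.metric_sym te1 te0) /= expr0 expr1 /g00 /g01 /g11 /e0 /e1; ring.
Qed.

Let g00_gt0 : 0 < g00.
Proof.
apply: metric_pos => //; apply/eqP => /(congr1 (fun x => x c 0 ord0)).
by rewrite dd_self// eqxx mxE; apply/eqP; rewrite oner_neq0.
Qed.

(** The Gram-Schmidt vector orthogonal to [e0], scaled by [g00] to avoid division. Its squared
    length is [g00] times the determinant of the metric, so positive definiteness gives the sign of
    that determinant. *)
Let v := g00 *: e1 - g01 *: e0.

Let tv : tangent p v.
Proof. by apply: tangentD; [|apply: tangentN]; exact: tangentZ. Qed.

Let metric_e0v : metric p e0 v = 0.
Proof.
rewrite metricBr//; do ?exact: tangentZ.
by rewrite !metricZr// mulrC subrr.
Qed.

Let metric_vv : metric p v v = g00 * \det (gij c p).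
Proof.
rewrite {1}/v metricBl//; do ?exact: tangentZ.
rewrite !metricZl// metric_e0v mulr0 subr0 metricBr//; do ?exact: tangentZ.
by rewrite !metricZr// (Defs.metric_sym te1 te0) det_gijE -/g11 -/g01 expr2.
Qed.

Lemma det_gij_gt0 : 0 < \det (gij c p).
Proof.
rewrite -(pmulr_rgt0 _ g00_gt0) -metric_vv; apply: metric_pos => //.
(* The vector [v] is nonzero because its component along [e1] is [g00]. *)
apply/eqP => /(congr1 (fun x => x c 0 ord_max)); rewrite !(fctE, mxE).
rewrite !dd_self// eqxx mulr1 (_ : (ord0 == ord_max) = false)// mulr0 subr0.
by apply/eqP; rewrite gt_eqF.
Qed.

Let K := gaussian_curvature D c p.

Lemma surface_riemann x y w : tangent p x -> tangent p y -> tangent p w ->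
  metric p (riemann (D := D) (c := c) (p := p) y x x) w =
  K * (metric p x x * metric p y w - metric p x y * metric p x w).
Proof.
move=> tx ty tw; apply: (mulfI (lt0r_neq0 det_gij_gt0)).
rewrite /K /gaussian_curvature mulrA mulrCA.
rewrite mulfV ?lt0r_neq0 ?det_gij_gt0// mulr1.
rewrite (metric_riemann HD cp y x x tw) (metric_coord cp tx tx).
rewrite (metric_coord cp ty tw) (metric_coord cp tx ty) (metric_coord cp tx tw).
have -> : \det (gij c p) = gij c p ord0 ord0 * gij c p ord_max ord_max -
    gij c p ord0 ord_max ^+ 2 by rewrite det_gijE !mxE.
apply: surface_identity => [i j|i j k l|i j k l].
- exact: gijC.
- exact: (Rijkl_skewl HD cp).
- exact: (Rijkl_skewr HD cp).
Qed.

Lemma orthonormal_pair : exists x y, [/\ tangent p x, tangent p y,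
  metric p x x = 1, metric p y y = 1 & metric p x y = 0].
Proof.
have vv0 : 0 < metric p v v by rewrite metric_vv mulr_gt0// det_gij_gt0.
have normalize u : tangent p u -> 0 < metric p u u ->
    let u' := (Num.sqrt (metric p u u))^-1 *: u in metric p u' u' = 1.
  move=> tu u0 /=; rewrite metricZl//; last exact: tangentZ.
  rewrite metricZr// mulrA -expr2 exprVn sqr_sqrtr ?ltW// mulVf ?lt0r_neq0//.
exists ((Num.sqrt (metric p e0 e0))^-1 *: e0),
  ((Num.sqrt (metric p v v))^-1 *: v).
split; [exact: tangentZ|exact: tangentZ|exact: normalize|exact: normalize|].
by rewrite metricZl ?metricZr ?metric_e0v ?mulr0//; exact: tangentZ.
Qed.

End Surface.

Theorem proposition1 (R : realType) (M : riemannian R 2)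
    (nabla : tfield M -> tfield M -> tfield M) (Hnabla : levi_civita nabla)
    (p : M) (c : chart_index M) (Hc : Dom c p) (zeta : R) (Hzeta : zeta != 0) :
  M_eigenvalue nabla p zeta <-> zeta = gaussian_curvature nabla c p.
Proof.
split=> [[x [y [tx ty /(riemann_atP Hnabla Hc _ ty tx tx) yxx _ [xx yy]]]]|->].
  have key w (tw : tangent p w) := surface_riemann Hnabla Hc tx ty tw.
  have := key x tx; rewrite yxx metricZl// xx mul1r mulr1.
  rewrite (Defs.metric_sym ty tx).
  rewrite subrr mulr0 => /eqP; rewrite mulf_eq0 (negbTE Hzeta) /= => /eqP xy.
  by have := key y ty; rewrite yxx metricZl// xx yy xy mul0r subr0 !mulr1.
have [x [y [tx ty xx yy xy]]] := orthonormal_pair Hc.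
(* Leaving [u] and [v] general lets one claim serve both eigenvector equations, with [x] and [y]
   exchanged. The equality of vectors is tested against every tangent [w], by nondegeneracy of the
   metric. *)
have eigen u v : tangent p u -> tangent p v -> metric p u u = 1 ->
    metric p u v = 0 ->
    riemann_at nabla p v u u (gaussian_curvature nabla c p *: v).
  move=> tu tv uu uv; apply/(riemann_atP Hnabla Hc _ tv tu tu).
  apply/eqP; rewrite -subr_eq0; apply/eqP.
  have tr := tangent_riemann Hnabla Hc v u u.
  apply: (@metric_nondegenerate _ _ _ p) => [|w tw].
    by apply: tangentD => //; apply: tangentN; exact: tangentZ.
  rewrite metricBl//; last exact: tangentZ.
  rewrite (surface_riemann Hnabla Hc tu tv tw) uu uv.
  by rewrite mul1r mul0r subr0 metricZl// subrr.
exists x, y; split => //; first exact: eigen.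
by apply: eigen => //; rewrite (Defs.metric_sym ty tx).
Qed.
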